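(* Let $\Sigma$ be a tangled signed graph. Then $\Sigma$ is $2$-connected if and only if the signed-graphic matroid $M(\Sigma)$ is connected.
   Context: A signed graph $\Sigma=(G,\sigma)$ consists of a finite graph $G$ whose edges may be links $\{u,v\}$ ($u\neq v$), loops $\{v,v\}$, half-edges $\{v\}$ or loose edges $\emptyset$, and a sign function $\sigma:E(G)\to\{\pm1\}$ with every half-edge negative and every loose edge positive. The sign of a cycle is the product of the signs of its edges (negative loops and half-edges are negative cycles). $\Sigma$ is balanced if it has no negative cycle; a vertex $v$ is a balancing vertex if deleting $v$ and all edges incident to it leaves a balanced signed graph. The signed-graphic matroid $M(\Sigma)$ has ground set $E(\Sigma)$ and circuits the edge sets of subgraphs that are (i) a positive cycle, (ii) two vertex-disjoint negative cycles joined by a path meeting the cycles only in its end-vertices, or (iii) two negative cycles having exactly one common vertex. A connected signed graph is tangled if it has no balancing vertex and no two vertex-disjoint negative cycles. Connectivity of graphs is Tutte connectivity: for $k\ge1$, a $k$-separation of a connected graph is a partition $\{A,B\}$ of its edges with $\min\{|A|,|B|\}\ge k$ such that the subgraphs induced by $A$ and by $B$ share exactly $k$ vertices; a graph is $2$-connected if it is connected and has no $1$-separation. *)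

(* Defs.v *)
From mathcomp Require Import all_boot all_order all_algebra.

Set Implicit Arguments.
Unset Strict Implicit.
Unset Printing Implicit Defensive.

Import GRing.Theory.
Local Open Scope ring_scope.

(* The four kinds of edges are told apart by the number of end-vertices:      *)
(* two for a link, none for a loose edge, one for a loop or a half-edge; the  *)
(* set [half] separates the half-edges from the loops.  Parallel edges are    *)
(* allowed, since [ends] need not be injective.                               *)
Record graph (V E : finType) := Graph {
  ends : E -> {set V};
  half : {set E};
  ends_le2 : forall e, (#|ends e| <= 2)%N;
  half_ends : forall e, e \in half -> #|ends e| = 1%N
}.

Record signed_graph (V E : finType) := SignedGraph {
  ugraph :> graph V E;
  sigma : E -> int;
  sigma_pm1 : forall e, sigma e = 1 \/ sigma e = -1;
  sigma_half : forall e, e \in half ugraph -> sigma e = -1;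
  sigma_loose : forall e, ends ugraph e = set0 -> sigma e = 1
}.

Section Graphs.
Variables (V E : finType) (G : graph V E).

(* Vertex set of the subgraph induced by a set of edges. *)
Definition verts (A : {set E}) : {set V} := \bigcup_(e in A) ends G e.

(* For x = y this says that e is a loop at x, because [set x; x] = [set x]. *)
Definition joins (e : E) (x y : V) : bool :=
  (e \notin half G) && (ends G e == [set x; y]).

(* [walk x [:: (e1, x1); (e2, x2); ...]]: the walk x, e1, x1, e2, x2, ... *)
Fixpoint walk (x : V) (w : seq (E * V)) : bool :=
  if w is (e, y) :: w' then joins e x y && walk y w' else true.

Definition walk_end (x : V) (w : seq (E * V)) : V := last x (unzip2 w).

Definition walk_edges (w : seq (E * V)) : {set E} := [set e in unzip1 w].

Definition walk_verts (x : V) (w : seq (E * V)) : {set V} :=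
  [set y in x :: unzip2 w].

Definition simple_path (x : V) (w : seq (E * V)) : bool :=
  walk x w && uniq (x :: unzip2 w).

(* Distinctness of the edges only matters for length 2: it prevents a single  *)
(* link traversed back and forth from counting as a closed path.              *)
Definition closed_path (x : V) (w : seq (E * V)) : bool :=
  [&& w != [::], walk x w, walk_end x w == x,
      uniq (unzip2 w) & uniq (unzip1 w)].

(* Cycles are identified with their edge sets.  Loops are closed paths of     *)
(* length 1.  A half-edge is a cycle on its own and, following Zaslavsky, so  *)
(* is a loose edge: it is positive, hence a one-element circuit of M(Sigma).  *)
Definition is_cycle (C : {set E}) : Prop :=
  [\/ exists x w, closed_path x w /\ C = walk_edges w,
      exists2 e, e \in half G & C = [set e]
    | exists2 e, ends G e = set0 & C = [set e]].

Definition incident (a b : V + E) : bool :=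
  match a, b with
  | inl v, inr e | inr e, inl v => v \in ends G e
  | _, _ => false
  end.

(* Any two objects (vertices or edges) are linked by an alternating sequence  *)
(* of incident vertices and edges.  Without loose edges this is the usual     *)
(* path-connectedness of the vertex set; a loose edge is a connected          *)
(* component by itself.                                                       *)
Definition connected_graph : Prop := forall a b : V + E, connect incident a b.

Definition is_separation (k : nat) (A B : {set E}) : Prop :=
  [/\ A :|: B = [set: E] /\ [disjoint A & B],
      (k <= minn #|A| #|B|)%N
    & #|verts A :&: verts B| = k].

Definition two_connected : Prop :=
  connected_graph /\ ~ exists A B, is_separation 1 A B.

End Graphs.

Section SignedGraphs.
Variables (V E : finType) (S : signed_graph V E).

Definition cycle_sign (C : {set E}) : int := \prod_(e in C) sigma S e.

Definition positive_cycle (C : {set E}) : Prop :=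
  is_cycle S C /\ cycle_sign C = 1.

Definition negative_cycle (C : {set E}) : Prop :=
  is_cycle S C /\ cycle_sign C = -1.

(* Balance of the signed subgraph with edge set F (isolated vertices are      *)
(* irrelevant to balance); S itself is balanced when F = [set: E].            *)
Definition balanced (F : {set E}) : Prop :=
  ~ exists2 C : {set E}, C \subset F & negative_cycle C.

Definition balancing_vertex (v : V) : Prop :=
  balanced [set e | v \notin ends S e].

Definition tangled : Prop :=
  [/\ connected_graph S,
      ~ exists v, balancing_vertex v
    & ~ exists C1 C2, [/\ negative_cycle C1, negative_cycle C2
                        & [disjoint verts S C1 & verts S C2]]].

Definition loose_handcuff (F : {set E}) : Prop :=
  exists C1 C2 x w,
    [/\ negative_cycle C1, negative_cycle C2
      & [disjoint verts S C1 & verts S C2]] /\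
    [/\ simple_path S x w,
        walk_verts x w :&: verts S C1 = [set x],
        walk_verts x w :&: verts S C2 = [set walk_end x w]
      & F = C1 :|: C2 :|: walk_edges w].

(* C1 <> C2 is needed because a negative loop or half-edge has exactly one    *)
(* vertex in common with itself.                                              *)
Definition tight_handcuff (F : {set E}) : Prop :=
  exists C1 C2,
    [/\ negative_cycle C1, negative_cycle C2, C1 <> C2,
        #|verts S C1 :&: verts S C2| = 1%N
      & F = C1 :|: C2].

(* The circuits of the signed-graphic matroid M(S), whose ground set is E. *)
Definition sg_circuit (F : {set E}) : Prop :=
  [\/ positive_cycle F, loose_handcuff F | tight_handcuff F].

End SignedGraphs.

(* Connectedness of the matroid on E with the given circuits. *)
Definition matroid_connected (E : finType) (circuit : {set E} -> Prop) : Prop :=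
  forall e f : E, e != f -> exists C, [/\ circuit C, e \in C & f \in C].

(* Main.v *)
Require Import Defs.
From mathcomp Require Import all_boot all_order all_algebra.
From mathcomp Require Import ring.
From Stdlib Require Import Classical.

(* A closed path cannot cross a 1-separation (A, B) with shared vertex v, so  *)
(* a circuit crossing it is a tight handcuff with one negative cycle on each  *)
(* side; a negative cycle avoiding v is then disjoint from one of the two.    *)
(*                                                                            *)
(* Conversely, represent M(S) over the rationals by the signed incidence      *)
(* matrix, so that its circuits are the minimal supports of the kernel, and   *)
(* sharing a circuit is transitive.  By connectedness it suffices to treat    *)
(* two edges a, b with a common end w.  As S - w is connected and unbalanced, *)
(* every vector supported on its vertices is the boundary of a chain of S - w;*)
(* hence some kernel element uses exactly a and b among the edges at w, and a *)
(* minimal support inside its support that contains a must contain b, for     *)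
(* otherwise a would be its only edge at w.                                   *)

Set Implicit Arguments.
Unset Strict Implicit.
Unset Printing Implicit Defensive.

Import GRing.Theory.
Local Open Scope ring_scope.

(** [cycle_space] is the kernel of the signed incidence matrix. A suitable chain along a walk has
    its boundary at the two ends only, so a positive closed path carries a nonzero kernel vector; a
    negative one carries none, but each of its vertices is the boundary of a chain on it. Hence
    nonempty minimal supports are circuits of [M(S)] ([min_support_circuit]). As negative cycles are
    never disjoint, only positive cycles and tight handcuffs arise. This one inclusion suffices,
    because matroid connectedness only asks for circuits to exist.

    In the 2-connected case, two edges at a vertex [w] share a minimal support
    ([adjacent_min_support]): [S - w] is connected and contains a negative cycle, so its chains
    realise every vertex other than [w] as a boundary ([off_fills]). The exchange argument
    [min_support_trans] then spreads this along the connected graph.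

    For the converse, [cycle_one_side] keeps every cycle on one side of a 1-separation, and
    [separation_circuit] derives two disjoint negative cycles from a circuit that meets both
    sides. *)

(** * Linear algebra: minimal supports as circuits of a matroid *)

Section MinimalSupports.
Variables (F : fieldType) (E : finType) (K : (E -> F) -> Prop).
Hypothesis KB : forall x y c, K x -> K y -> K (fun e => x e - c * y e).

Definition supp (x : E -> F) : {set E} := [set e | x e != 0].

(* The empty set qualifies, being the support of 0. *)
Definition min_support (Z : {set E}) : Prop :=
  (exists2 x, K x & supp x = Z) /\
  forall x, K x -> supp x != set0 -> supp x \subset Z -> supp x = Z.

Lemma min_support_eq Z1 Z2 :
  min_support Z1 -> Z1 != set0 -> min_support Z2 -> Z1 \subset Z2 -> Z1 = Z2.
Proof.
move=> [[x Kx <-] _] Zn0 [_ min2] sub; exact: min2.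
Qed.

(** Given a smaller support [supp y], pass to [y] if it contains [e]; otherwise subtracting a
    multiple of [y] from [x] kills another coordinate and keeps the one at [e]. *)
Lemma min_support_sub x e : K x -> x e != 0 ->
  exists Z, [/\ min_support Z, Z \subset supp x & e \in Z].
Proof.
have [n] := ubnP #|supp x|; elim: n x => // n IHn x; rewrite ltnS => le_n Kx xe.
have [[y [Ky yn0 yx]]|min_x] := classic (exists y, [/\ K y, supp y != set0
  & supp y \proper supp x]); last first.
  exists (supp x); split; rewrite ?inE //; split; first by exists x.
  move=> y Ky yn0 yx; apply/eqP; rewrite eqEproper yx /=.
  by apply/negP => yx'; case: min_x; exists y.
have lt_y : (#|supp y| < n)%N by apply: leq_trans (proper_card yx) le_n.
have [ye|] := boolP (y e == 0); last first.
  move=> ye; have [Z [mZ Zy eZ]] := IHn y lt_y Ky ye.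
  by exists Z; split=> //; apply: subset_trans Zy (proper_sub yx).
have /set0Pn[h hy] := yn0.
have hx : h \in supp x by apply: (subsetP (proper_sub yx)).
pose x' g := x g - x h / y h * y g.
have Kx' : K x' by apply: KB.
have x'h : x' h = 0 by rewrite /x' mulfVK ?subrr //; rewrite inE in hy.
have sub : supp x' \subset supp x.
  apply/subsetP => g; apply: contraLR => gx.
  have /negPn/eqP gy : ~~ (y g != 0).
    by apply: contra gx => gy; apply: (subsetP (proper_sub yx)); rewrite inE.
  by move: gx; rewrite !inE !negbK /x' gy mulr0 subr0.
have lt_x' : (#|supp x'| < n)%N.
  apply: leq_trans le_n; apply: proper_card.
  apply/properP; split=> //; exists h => //.
  by rewrite inE x'h eqxx.
have x'e : x' e != 0 by rewrite /x' (eqP ye) mulr0 subr0.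
have [Z [mZ Zx eZ]] := IHn x' lt_x' Kx' x'e.
by exists Z; split=> //; apply: subset_trans Zx sub.
Qed.

(** Strong circuit elimination: cancelling coordinate [h] leaves coordinate [e] unchanged, since [y]
    vanishes there. *)
Lemma min_support_elim Z1 Z2 e h :
    min_support Z1 -> min_support Z2 -> h \in Z1 -> h \in Z2 ->
    e \in Z1 -> e \notin Z2 ->
  exists Z, [/\ min_support Z, Z \subset (Z1 :|: Z2) :\ h & e \in Z].
Proof.
move=> [[x Kx <-] _] [[y Ky <-] _]; rewrite !inE negbK => xh yh xe /eqP ye.
pose z g := x g - x h / y h * y g.
have Kz : K z by apply: KB.
have ze : z e != 0 by rewrite /z ye mulr0 subr0.
have [Z [mZ sZ eZ]] := min_support_sub Kz ze.
exists Z; split=> //; apply: subset_trans sZ _; apply/subsetP => g.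
rewrite !inE => zg; apply/andP; split.
  by apply: contraNneq zg => ->; rewrite /z mulfVK ?subrr.
apply: contraR zg; rewrite negb_or !negbK => /andP[/eqP xg /eqP yg].
by rewrite /z xg yg mulr0 subr0.
Qed.

(** Induction on the size of the union. Eliminating [h] gives [Z3] through [e]; eliminating from
    [Z2] and [Z3] an [x] of [Z3] outside [Z1] gives [Z4] through [g]. Then [Z4] still meets [Z1],
    and their union has lost [x]. *)
Lemma min_support_trans Z1 Z2 e g h :
    min_support Z1 -> min_support Z2 -> h \in Z1 -> h \in Z2 ->
    e \in Z1 -> g \in Z2 ->
  exists Z, [/\ min_support Z, e \in Z & g \in Z].
Proof.
have [n] := ubnP #|Z1 :|: Z2|; elim: n Z1 Z2 h => // n IHn Z1 Z2 h.
rewrite ltnS => le_n m1 m2 h1 h2 e1 g2.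
have [e2|e2] := boolP (e \in Z2); first by exists Z2.
have [g1|g1] := boolP (g \in Z1); first by exists Z1.
have [Z3 [m3 s3 e3]] := min_support_elim m1 m2 h1 h2 e1 e2.
have [g3|g3] := boolP (g \in Z3); first by exists Z3.
have /subsetPn[x x3 x1] : ~~ (Z3 \subset Z1).
  apply/negP => s31; have Z31 : Z3 = Z1.
    by apply: min_support_eq => //; apply/set0Pn; exists e.
  by have := subsetP s3 h; rewrite Z31 h1 !inE eqxx => /(_ isT).
have x2 : x \in Z2.
  by have := subsetP s3 x x3; rewrite !inE (negPf x1) => /andP[].
have [Z4 [m4 s4 g4]] := min_support_elim m2 m3 x2 x3 g2 g3.
have /subsetPn[y y4 y2] : ~~ (Z4 \subset Z2).
  apply/negP => s42; have Z42 : Z4 = Z2.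
    by apply: min_support_eq => //; apply/set0Pn; exists g.
  by have := subsetP s4 x; rewrite Z42 x2 !inE eqxx => /(_ isT).
have y3 : y \in Z3.
  have := subsetP s4 y y4; rewrite !inE => /andP[_ /orP[|//]].
  by rewrite (negPf y2).
have y1 : y \in Z1.
  have := subsetP s3 y y3; rewrite !inE => /andP[_ /orP[//|]].
  by rewrite (negPf y2).
apply: (IHn Z1 Z4 y) => //; apply: leq_trans le_n.
apply: proper_card; apply/properP; split.
  apply/subsetP => a; rewrite !inE => /orP[->//|a4].
  have := subsetP s4 a a4; rewrite !inE => /andP[_ /orP[->|a3]].
    by rewrite orbT.
  by have := subsetP s3 a a3; rewrite !inE => /andP[].
exists x; first by rewrite inE x2 orbT.
rewrite inE negb_or x1; apply/negP => x4.
by have := subsetP s4 x x4; rewrite !inE eqxx.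
Qed.

End MinimalSupports.

(** * Walks, simple paths and closed paths *)

Section Walks.
Variables (V E : finType) (G : graph V E).
Implicit Types (x y z : V) (e : E) (w : seq (E * V)) (A B T : {set E}).

Lemma joins_sym e x y : joins G e x y = joins G e y x.
Proof. by rewrite /joins setUC. Qed.

Lemma walk_cat x w1 w2 :
  walk G x (w1 ++ w2) = walk G x w1 && walk G (walk_end x w1) w2.
Proof. by elim: w1 x => //= -[e y] w1 IHw x; rewrite IHw andbA. Qed.

Lemma walk_end_cat x w1 w2 :
  walk_end x (w1 ++ w2) = walk_end (walk_end x w1) w2.
Proof. by rewrite /walk_end /unzip2 map_cat last_cat. Qed.

Lemma walk_end_in x w : w != [::] -> walk_end x w \in unzip2 w.
Proof. by case: w => // -[e y] w _; rewrite /walk_end /= mem_last. Qed.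

Lemma walk_split x y w : y \in x :: unzip2 w ->
  exists w1 w2, w = w1 ++ w2 /\ walk_end x w1 = y.
Proof.
elim: w x => [|[e z] w IHw] x; rewrite inE.
  by move/eqP->; exists [::], [::].
case/orP => [/eqP->|yw]; first by exists [::], ((e, z) :: w).
by have [w1 [w2 [-> <-]]] := IHw z yw; exists ((e, z) :: w1), w2.
Qed.

Lemma walk_rev x w : walk G x w -> exists w',
  [/\ walk G (walk_end x w) w', walk_end (walk_end x w) w' = x,
      unzip1 w' = rev (unzip1 w)
    & walk_end x w :: unzip2 w' = rev (x :: unzip2 w)].
Proof.
elim: w x => [|[e y] w IHw] x /=; first by exists [::].
case/andP=> ej /IHw[w' [ww' we w1 w2]].
have -> : walk_end x ((e, y) :: w) = walk_end y w by [].
exists (w' ++ [:: (e, x)]); split.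
- by rewrite walk_cat ww' we /= joins_sym ej.
- by rewrite walk_end_cat.
- by rewrite /unzip1 map_cat [map _ w']w1 rev_cons cats1.
- by rewrite [unzip2 _]map_cat -cat_cons [_ :: map _ w']w2 [RHS]rev_cons -cats1.
Qed.

Lemma mem_verts A v : reflect (exists2 e, e \in A & v \in ends G e)
  (v \in verts G A).
Proof. exact: bigcupP. Qed.

Lemma vertsS A B : A \subset B -> verts G A \subset verts G B.
Proof.
move=> /subsetP sAB; apply/subsetP => v /mem_verts[e eA ve].
by apply/mem_verts; exists e => //; apply: sAB.
Qed.

Lemma verts_walk x w v : walk G x w -> v \in verts G (walk_edges w) ->
  v \in x :: unzip2 w.
Proof.
move=> ww /mem_verts[e]; rewrite inE.
elim: w x ww => //= -[d y] w IHw x /= /andP[/andP[_ /eqP jd] ww].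
rewrite inE => /orP[/eqP->|ew ve].
  by rewrite jd !inE => /orP[]->; rewrite ?orbT.
by rewrite inE (IHw y) ?orbT.
Qed.

Lemma walk_verts_sub x w v : walk G x w -> v \in unzip2 w ->
  v \in verts G (walk_edges w).
Proof.
elim: w x => //= -[d y] w IHw x /= /andP[/andP[_ /eqP jd] ww].
rewrite inE => /orP[/eqP->|vw]; apply/mem_verts.
  by exists d; rewrite ?jd !inE eqxx ?orbT.
have /mem_verts[e ew ve] := IHw y ww vw.
by exists e => //; move: ew; rewrite !inE orbC => ->.
Qed.

Lemma verts_closed x w : closed_path G x w ->
  verts G (walk_edges w) =i unzip2 w.
Proof.
case/and5P=> wn0 ww /eqP we _ _ v; apply/idP/idP; last exact: walk_verts_sub ww.
move/(verts_walk ww); rewrite inE => /orP[/eqP->|//].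
by rewrite -[X in X \in _]we walk_end_in.
Qed.

Lemma closed_path_rot x w1 w2 : closed_path G x (w1 ++ w2) ->
  closed_path G (walk_end x w1) (w2 ++ w1).
Proof.
case/and5P; rewrite walk_cat walk_end_cat => wn0 /andP[ww1 ww2] /eqP we u2 u1.
apply/and5P; split.
- by move: wn0; rewrite -!size_eq0 !size_cat addnC.
- by rewrite walk_cat ww2 we.
- by rewrite walk_end_cat we.
- by move: u2; rewrite /unzip2 !map_cat uniq_catC.
- by move: u1; rewrite /unzip1 !map_cat uniq_catC.
Qed.

Lemma walk_edges_catC w1 w2 : walk_edges (w1 ++ w2) = walk_edges (w2 ++ w1).
Proof.
by apply/setP => e; rewrite !inE /unzip1 !map_cat !mem_cat orbC.
Qed.

Lemma closed_path_at x w y : closed_path G x w -> y \in unzip2 w ->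
  exists2 w', closed_path G y w' & walk_edges w' = walk_edges w.
Proof.
move=> cw yw; have [w1 [w2 [ew1 ew2]]] : exists w1 w2,
  w = w1 ++ w2 /\ walk_end x w1 = y by apply: walk_split; rewrite inE yw orbT.
exists (w2 ++ w1); last by rewrite walk_edges_catC ew1.
by rewrite -ew2; apply: closed_path_rot; rewrite -ew1.
Qed.

Lemma simple_path_edges x w : simple_path G x w -> uniq (unzip1 w).
Proof.
elim: w x => //= -[e y] w IHw x /andP[/= /andP[/andP[_ /eqP je] ww]].
move=> /andP[xw uw]; rewrite (IHw y) ?andbT; last by rewrite /simple_path ww.
apply: contra xw => ew; apply: verts_walk ww _.
by apply/mem_verts; exists e; rewrite ?inE // je !inE eqxx.
Qed.

Lemma simple_path_rev x w : simple_path G x w -> exists w',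
  [/\ simple_path G (walk_end x w) w', walk_end (walk_end x w) w' = x,
      unzip1 w' = rev (unzip1 w)
    & walk_end x w :: unzip2 w' = rev (x :: unzip2 w)].
Proof.
case/andP=> /walk_rev[w' [ww' we w1 w2]] u; exists w'; split=> //.
by rewrite /simple_path ww' w2 rev_uniq.
Qed.

(** Replacing an arc of a cycle by an ear with the same ends; used twice, it gives the other two
    cycles of a theta graph. *)
Lemma theta_closed_path x y P Q R :
    closed_path G x (P ++ Q) -> walk_end x P = y -> P != [::] ->
    simple_path G x R -> walk_end x R = y -> R != [::] ->
    (forall v, v \in x :: unzip2 R -> v \in verts G (walk_edges (P ++ Q)) ->
       v = x \/ v = y) ->
    [disjoint walk_edges R & walk_edges (P ++ Q)] ->
  closed_path G x (R ++ Q).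
Proof.
move=> cPQ eP Pn0 sR eR Rn0 RT dR; have vPQ := verts_closed cPQ.
case/and5P: (cPQ); rewrite walk_cat walk_end_cat eP.
move=> _ /andP[wP wQ] /eqP eQ; rewrite /unzip2 /unzip1 !map_cat !cat_uniq.
move=> /and3P[uP2 dPQ uQ2] /and3P[uP1 _ uQ1].
have uR1 := simple_path_edges sR; case/andP: sR => wR /= /andP[xR uR].
apply/and5P; split.
- by move: Rn0; case: (R).
- by rewrite walk_cat wR eR.
- by rewrite walk_end_cat eR eQ.
- rewrite /unzip2 map_cat cat_uniq uR uQ2 andbT; apply/hasPn => v vQ.
  apply/negP => vR; have vPQ' : v \in verts G (walk_edges (P ++ Q)).
    by rewrite vPQ /unzip2 map_cat mem_cat vQ orbT.
  have [|vx|vy] := RT v _ vPQ'; first by rewrite inE vR orbT.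
    by move: vR; rewrite vx (negPf xR).
  by move/hasPn/(_ v vQ): dPQ; rewrite vy -eP walk_end_in.
- rewrite /unzip1 map_cat cat_uniq uR1 uQ1 andbT; apply/hasPn => e eQ1.
  apply/negP => eR1; have /pred0P/(_ e) := dR.
  by rewrite /= !inE eR1 /unzip1 map_cat mem_cat eQ1 orbT.
Qed.

End Walks.

(** * Ears in graphs whose edges are all links *)

Section Ears.
Variables (V E : finType) (G : graph V E).
Hypothesis links : forall e, #|ends G e| = 2%N.
Implicit Types (x y z v : V) (e : E) (w : seq (E * V)).
Implicit Types (A B F : {set E}) (T : {set V}).

Lemma link_not_half e : e \notin Defs.half G.
Proof. by apply/negP => /half_ends; rewrite links. Qed.

Lemma joins_neq e x y : joins G e x y -> x != y.
Proof.
by case/andP=> _ /eqP je; have := links e; rewrite je cards2; case: eqVneq.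
Qed.

Lemma joins_ends e x : x \in ends G e -> exists y, joins G e x y.
Proof.
have /eqP/cards2P[u [v [uv ev]]] := links e; rewrite /joins link_not_half ev.
rewrite !inE => /orP[]/eqP->; first by exists v; rewrite eqxx.
by exists u; rewrite setUC eqxx.
Qed.

(** The ends need not lie in [T]: this describes a path still being grown. *)
Definition ear F T x w :=
  [/\ simple_path G x w, w != [::], walk_edges w \subset F
    & forall v, v \in x :: unzip2 w -> v \in T -> v = x \/ v = walk_end x w].

Definition closed_ear F T x w :=
  [/\ closed_path G x w, walk_edges w \subset F
    & forall v, v \in unzip2 w -> v \in T -> v = x].

Lemma ear_rev F T x w : ear F T x w -> exists w',
  [/\ ear F T (walk_end x w) w', walk_end (walk_end x w) w' = x
    & size w' = size w].
Proof.
case=> sw wn0 wF wT; have [w' [sw' ew' w1 w2]] := simple_path_rev sw.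
have size_w : size w' = size w.
  by have := congr1 size w1; rewrite size_rev !size_map.
exists w'; split=> //; split=> //.
- by rewrite -size_eq0 size_w size_eq0.
- apply: subset_trans wF; apply/subsetP => e.
  by rewrite !inE w1 mem_rev.
- by move=> v; rewrite w2 mem_rev ew' => vw /(wT v vw)[]; [right|left].
Qed.

(** A second edge at [x] either lengthens the path or runs back into it at some [z], where it closes
    up. *)
Lemma ear_extend F T x w :
    (forall v e, v \notin T -> e \in F -> v \in ends G e ->
       exists2 g, g \in F & (g != e) && (v \in ends G g)) ->
    ear F T x w -> x \notin T ->
  (exists z w', closed_ear F T z w') \/
  (exists z e, ear F T z ((e, x) :: w)).
Proof.
move=> deg2 [sw wn0 wF wT] xT; have w1u := simple_path_edges sw.
case/andP: sw => ww /= /andP[xw uw].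
have [g [gF gw] [z gz]] : exists2 g, g \in F /\ g \notin unzip1 w
    & exists z, joins G g x z.
  case: w ww xw uw w1u wn0 wF {wT} => // -[e y] w /=.
  move=> /andP[/andP[_ /eqP je] ww] xw _ _ _ /subsetP wF.
  have eF : e \in F by apply: wF; rewrite !inE eqxx.
  have [|g gF /andP[ge xg]] := deg2 x e xT eF; first by rewrite je !inE eqxx.
  have [z gz] := joins_ends xg; exists g; last by exists z.
  split=> //; rewrite inE (negPf ge) /=; apply: contra xw => gw.
  by apply: verts_walk ww _; apply/mem_verts; exists g; rewrite ?inE.
have zx : z != x by rewrite eq_sym; apply: joins_neq gz.
have [zw|zw] := boolP (z \in unzip2 w); last first.
  right; exists z, g; split=> //.
  - rewrite /simple_path /= joins_sym gz ww /= xw uw andbT.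
    by rewrite inE negb_or zx zw.
  - by apply/subsetP => e; rewrite !inE => /orP[/eqP->//|ew];
      apply: (subsetP wF); rewrite inE.
  - move=> v; rewrite inE => /orP[/eqP->|vw vT]; first by left.
    have [vx|->] := wT v vw vT; last by right.
    by rewrite -vx vT in xT.
left; have [w1 [w2 [ew1 ew2]]] : exists w1 w2, w = w1 ++ w2 /\ walk_end x w1 = z.
  by apply: walk_split; rewrite inE zw orbT.
move: ww uw xw w1u gw; rewrite {1}ew1 walk_cat => /andP[ww1 _].
rewrite ew1 /unzip1 /unzip2 !map_cat !cat_uniq !mem_cat.
move=> /and3P[u2 d2 _] /norP[xw1 _] /and3P[u1 _ _] /norP[gw1 _].
exists z, ((g, x) :: w1); split.
- by rewrite /closed_path /= joins_sym gz ww1 xw1 u2 gw1 u1 -ew2 /walk_end eqxx.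
- apply/subsetP => e; rewrite !inE => /orP[/eqP->//|ew1'].
  by apply: (subsetP wF); rewrite inE ew1 /unzip1 map_cat mem_cat ew1'.
move=> v; rewrite inE => /orP[/eqP->|vw1 vT]; first by rewrite (negPf xT).
have [|vx|] := wT v _ vT; first by rewrite ew1 inE /unzip2 map_cat mem_cat vw1 orbT.
  by rewrite -vx vT in xT.
(* A vertex of [T] on [w1] is the far end of [w]. Vertices do not repeat, so [w2] is empty and this
   vertex is [z]. *)
rewrite ew1 walk_end_cat ew2; case: (w2) d2 => [//|p w2'] d2 vE.
have vw2 : v \in unzip2 (p :: w2') by rewrite vE walk_end_in.
by move/hasPn/(_ v vw2): d2; rewrite vw1.
Qed.

(** Grow a path at an end outside [T], reversing it if necessary; its vertices are distinct, so this
    stops. *)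
Lemma ear_exists F T : F != set0 ->
    (forall v e, v \notin T -> e \in F -> v \in ends G e ->
       exists2 g, g \in F & (g != e) && (v \in ends G g)) ->
  (exists z w, closed_ear F T z w) \/
  (exists x w, [/\ ear F T x w, x \in T & walk_end x w \in T]).
Proof.
move=> /set0Pn[e eF] deg2.
have [x [w earxw]] : exists x w, ear F T x w.
  have [x xe] : exists x, x \in ends G e.
    by apply/set0Pn; rewrite -card_gt0 links.
  have [y je] := joins_ends xe; exists x, [:: (e, y)]; split=> //.
  - by rewrite /simple_path /= je !inE (joins_neq je).
  - by apply/subsetP => g; rewrite !inE => /eqP->.
  - by move=> v; rewrite !inE /walk_end /= => /orP[]/eqP->; [left|right].
have [n] := ubnP (#|V| - size w)%N; elim: n x w earxw => // n IHn x w earxw.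
rewrite ltnS => le_n.
have grow y w' : ear F T y w' -> size w' = size w -> y \notin T ->
    (exists z w, closed_ear F T z w) \/
    (exists x w, [/\ ear F T x w, x \in T & walk_end x w \in T]).
  move=> eary sw' yT; have [|[z [g earz]]] := ear_extend deg2 eary yT.
    by left.
  apply: IHn earz _; apply: leq_trans le_n; rewrite /= sw'.
  apply: ltn_sub2l => //; have [/andP[_ uw] _ _ _] := earxw.
  by have := max_card [in x :: unzip2 w]; rewrite (card_uniqP uw) /= size_map.
have [xT|xT] := boolP (x \in T); last exact: grow earxw _ xT.
have [yT|yT] := boolP (walk_end x w \in T); first by right; exists x, w.
by have [w' [earw' _ sw']] := ear_rev earxw; apply: grow earw' _ yT.
Qed.

End Ears.

(** * 1-separations and the cycles that cannot cross them *)

Section Separations.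
Variables (V E : finType) (G : graph V E).
Implicit Types (x y z v : V) (e : E) (w : seq (E * V)) (A B : {set E}).

(** Otherwise membership in [A], or in its vertex set, would propagate along incidences from [a] to
    [b]. *)
Lemma connected_verts A B : connected_graph G -> A :|: B = [set: E] ->
  A != set0 -> B :\: A != set0 -> verts G A :&: verts G B != set0.
Proof.
move=> conG AB /set0Pn[a aA] /set0Pn[b]; rewrite inE => /andP[bA bB].
apply/negP => /eqP AB0.
have /connectP[p] := conG (inr a) (inr b).
pose inA (t : V + E) := match t with inl v => v \in verts G A | inr e => e \in A end.
suff closed_A : forall t p, path (@incident V E G) t p -> inA t -> inA (last t p).
  by move=> pp lp; have := closed_A _ _ pp aA; rewrite -lp /= (negPf bA).
move=> t p'; elim: p' t => //= s p' IHp t /andP[ts pp] At; apply: IHp pp _.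
case: t s ts At => [v|e] [u|g] //=.
- move=> vg vA; have : g \in A :|: B by rewrite AB.
  rewrite inE => /orP[//|gB].
  have : v \in verts G A :&: verts G B.
    by rewrite inE vA; apply/mem_verts; exists g.
  by rewrite AB0 inE.
- by move=> ue eA; apply/mem_verts; exists e.
Qed.

(** An edge with at most one end, set against all other edges, is a 1-separation: a second edge
    keeps the other side nonempty, and connectedness rules out sharing no vertex. *)
Lemma two_connected_links e f : two_connected G -> e != f ->
  forall g, #|ends G g| = 2%N.
Proof.
case=> conG nsep ef g; apply/eqP; rewrite eqn_leq ends_le2 ltnNge.
apply/negP => g1; apply: nsep; exists [set g], (~: [set g]).
have [h hg] : exists h, h \notin [set g].
  have [ge|ge] := eqVneq e g; [exists f|exists e]; rewrite inE //.
  by rewrite -ge eq_sym.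
have gC : [set g] :|: ~: [set g] = [set: E] by rewrite setUCr.
have h_n0 : ~: [set g] :\: [set g] != set0.
  by apply/set0Pn; exists h; rewrite !inE in hg *; rewrite hg.
have g_n0 : [set g] != set0 by apply/set0Pn; exists g; rewrite inE.
split.
- by rewrite gC -setI_eq0 setICr.
- rewrite leq_min cards1 /= card_gt0; apply/set0Pn; exists h.
  by rewrite inE.
- apply/eqP; rewrite eqn_leq card_gt0 connected_verts // andbT.
  by rewrite (leq_trans _ g1) // subset_leq_card // {1}/verts big_set1 subsetIl.
Qed.

(* A walk can change sides of a 1-separation only at the shared vertex. *)
Lemma walk_one_side A B v x e y w :
    A :|: B = [set: E] -> verts G A :&: verts G B \subset [set v] ->
    walk G x ((e, y) :: w) -> v \notin belast y (unzip2 w) -> e \in A ->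
    B :&: A = set0 ->
  walk_edges ((e, y) :: w) \subset A.
Proof.
move=> AB ABv + + + BA0; elim: w x e y => [|[g z] w IHw] x e y.
  by move=> _ _ eA; apply/subsetP => h; rewrite !inE => /eqP->.
move=> /= /andP[/andP[_ /eqP je] /andP[jg ww]].
rewrite inE negb_or => /andP[vy vw] eA.
have gA : g \in A.
  have : g \in A :|: B by rewrite AB.
  rewrite inE => /orP[//|gB]; have /subsetP/(_ y) := ABv.
  rewrite !inE eq_sym (negPf vy) => yAB.
  have : false; last by [].
  apply: yAB; apply/andP; split; apply/mem_verts.
    by exists e; rewrite // je !inE eqxx orbT.
  by exists g => //; case/andP: jg => _ /eqP->; rewrite !inE eqxx.
apply/subsetP => h; rewrite !inE => /orP[/eqP->//|hw].
have sub : walk_edges ((g, z) :: w) \subset A by apply: (IHw y); rewrite /= ?jg.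
by apply: (subsetP sub); rewrite !inE.
Qed.

(** A path through [v] is rotated to start there, so that [v] is never an interior vertex. *)
Lemma closed_path_one_side A B v x w :
    A :|: B = [set: E] -> B :&: A = set0 ->
    verts G A :&: verts G B \subset [set v] -> closed_path G x w ->
  walk_edges w \subset A \/ walk_edges w \subset B.
Proof.
move=> AB BA0 ABv cw.
have [x' [w' [cw' <- vw]]] : exists x' w', [/\ closed_path G x' w',
    walk_edges w' = walk_edges w
  & forall e y w1, w' = (e, y) :: w1 -> v \notin belast y (unzip2 w1)].
  have [vw|vw] := boolP (v \in unzip2 w).
    have [w' cw' ew'] := closed_path_at cw vw; exists v, w'; split=> // e y w1 ew1.
    move: cw'; rewrite ew1 => /and5P[_ _ /eqP we u2 _].
    move: u2; rewrite /= -/(unzip2 w1) -(cons_uniq y) lastI rcons_uniq.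
    by move: we; rewrite /walk_end /= => -> /andP[].
  exists x, w; split=> // e y w1 ew1; apply: contra vw => /mem_belast.
  by rewrite ew1.
case: w' cw' vw => [|[e y] w1]; first by case/and5P.
case/and5P=> _ ww _ _ _ /(_ e y w1 erefl) vw1.
have : e \in A :|: B by rewrite AB.
rewrite inE => /orP[eA|eB]; [left|right].
  exact: (walk_one_side AB ABv ww).
apply: (walk_one_side (B := A) (v := v) _ _ ww) => //.
- by rewrite setUC.
- by rewrite setIC.
- by rewrite setIC.
Qed.

Lemma cycle_one_side A B v C : A :|: B = [set: E] -> B :&: A = set0 ->
    verts G A :&: verts G B \subset [set v] -> is_cycle G C ->
  C \subset A \/ C \subset B.
Proof.
move=> AB BA0 ABv [[x [w [cw ->]]]|[e _ ->]|[e _ ->]].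
- exact: (closed_path_one_side AB BA0 ABv cw).
all: by rewrite !sub1set; apply/orP; rewrite -in_setU AB.
Qed.

End Separations.

(** * The signed incidence matrix and its minimal dependencies *)

Section Incidence.
Variables (V E : finType) (S : signed_graph V E).
Hypothesis links : forall e, #|ends S e| = 2%N.
Implicit Types (x y z v : V) (e g : E) (w : seq (E * V)) (A B Z : {set E}).
Implicit Types (f h : E -> rat).

(* Up to a global sign per edge, the column of e is v - sigma(e) u for its   *)
(* ends u, v; [pick] chooses which of the two gets the coefficient 1.         *)
Definition inc e v : rat :=
  if v \in ends S e
  then (if [pick u in ends S e] == Some v then 1 else - (sigma S e)%:~R)
  else 0.

Definition bd f v : rat := \sum_e f e * inc e v.

Definition cycle_space f : Prop := forall v, bd f v = 0.

(** This says that [p] lies in the span of the columns of [A]. *)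
Definition fills A (p : V -> rat) : Prop :=
  exists2 f, supp f \subset A & forall v, bd f v = p v.

Definition wsign w : int := \prod_(e <- unzip1 w) sigma S e.

Lemma sigma_neq0 e : (sigma S e)%:~R != 0 :> rat.
Proof. by case: (sigma_pm1 S e) => ->. Qed.

Lemma sigma_sqr e : (sigma S e)%:~R * (sigma S e)%:~R = 1 :> rat.
Proof. by case: (sigma_pm1 S e) => ->. Qed.

Lemma inc_eq0 e v : (inc e v == 0) = (v \notin ends S e).
Proof.
rewrite /inc; case: ifP => // _; case: ifP => // _.
by rewrite oppr_eq0 (negPf (sigma_neq0 e)).
Qed.

Lemma inc_joins e x y : joins S e x y -> exists2 c : rat, c != 0 &
  forall v, c * inc e v = (v == x)%:R - (sigma S e)%:~R * (v == y)%:R.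
Proof.
move=> je; have xy := joins_neq links je; case/andP: je => _ /eqP je.
rewrite /inc je; case: pickP => [u|/(_ x)]; last by rewrite !inE eqxx.
rewrite !inE => /orP[]/eqP->; [exists 1 => //|exists (- (sigma S e)%:~R)].
- move=> v; rewrite mul1r !inE (inj_eq Some_inj) (eq_sym x v).
  have [->|vx] := eqVneq v x; first by rewrite (negPf xy) mulr0 subr0.
  by case: (eqVneq v y) => _; rewrite ?mulr1 ?mulr0 sub0r ?oppr0.
- by rewrite oppr_eq0 sigma_neq0.
- move=> v; rewrite !inE (inj_eq Some_inj) (eq_sym y v).
  have [->|vx] := eqVneq v x.
    by rewrite (negPf xy) mulr0 subr0 mulrNN sigma_sqr.
  by case: (eqVneq v y) => _; rewrite ?mulr1 ?mulr0 sub0r ?oppr0.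
Qed.

Lemma bdB f h c v : bd (fun e => f e - c * h e) v = bd f v - c * bd h v.
Proof.
rewrite /bd mulr_sumr -sumrB; apply: eq_bigr => e _.
by rewrite mulrBl mulrA.
Qed.

Lemma bd_edge e c v : bd (fun g => c * (g == e)%:R) v = c * inc e v.
Proof.
rewrite /bd (bigD1 e) //= eqxx mulr1 big1 ?addr0 // => g /negPf->.
by rewrite mulr0 mul0r.
Qed.

Lemma cycle_spaceB f h c : cycle_space f -> cycle_space h ->
  cycle_space (fun e => f e - c * h e).
Proof. by move=> Kf Kh v; rewrite bdB Kf Kh mulr0 subr0. Qed.

Lemma suppB f h c A : supp f \subset A -> supp h \subset A ->
  supp (fun e => f e - c * h e) \subset A.
Proof.
move=> /subsetP fA /subsetP hA; apply/subsetP => e; rewrite inE.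
have [fe|fe _] := eqVneq (f e) 0; last by apply: fA; rewrite inE.
have [he|he _] := eqVneq (h e) 0; last by apply: hA; rewrite inE.
by rewrite fe he mulr0 subr0 eqxx.
Qed.

Lemma suppP f A e : supp f \subset A -> e \notin A -> f e = 0.
Proof.
by move=> /subsetP/(_ e) fA; rewrite inE in fA; apply: contraNeq.
Qed.

Lemma fillsB A p q c : fills A p -> fills A q -> fills A (fun v => p v - c * q v).
Proof.
case=> f fA fp [h hA hq]; exists (fun e => f e - c * h e); first exact: suppB.
by move=> v; rewrite bdB fp hq.
Qed.

Lemma eq_fills A p q : p =1 q -> fills A p -> fills A q.
Proof. by move=> pq [f fA fp]; exists f => // v; rewrite fp pq. Qed.

Lemma fills0 A : fills A (fun=> 0).
Proof.
exists (fun=> 0); first by apply/subsetP => e; rewrite inE eqxx.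
by move=> v; rewrite /bd big1 // => e _; rewrite mul0r.
Qed.

Lemma fillsZ A p c : fills A p -> fills A (fun v => c * p v).
Proof.
move=> Ap; have := fillsB (- c) (fills0 A) Ap; apply: eq_fills => v.
by rewrite sub0r mulNr opprK.
Qed.

Lemma fillsS A B p : A \subset B -> fills A p -> fills B p.
Proof. by move=> AB [f fA fp]; exists f => //; apply: subset_trans AB. Qed.

(** Columns weighted by the sign of the walk before them telescope. The last clause later certifies
    that the chain of a closed path is nonzero. *)
Lemma walk_fills_head x w : walk S x w -> exists f, [/\ supp f \subset walk_edges w,
    forall v, bd f v = (v == x)%:R - (wsign w)%:~R * (v == walk_end x w)%:R
  & if w is (e, y) :: w' then e \notin unzip1 w' -> f e != 0 else True].
Proof.
elim: w x => [|[e y] w IHw] x.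
  move=> _; have [f fA fp] := fills0 set0; exists f; split=> //.
  by move=> v; rewrite fp /wsign big_nil mul1r subrr.
case/andP=> je /IHw[f [fA fp _]]; have [c c0 cp] := inc_joins je.
exists (fun g => c * (g == e)%:R - (- (sigma S e)%:~R) * f g); split.
- apply: suppB; apply/subsetP => g; rewrite !inE.
    by have [->|ge] := eqVneq g e; rewrite ?eqxx ?mulr0 ?eqxx.
  by move=> fg; apply/orP; right; have := subsetP fA g; rewrite !inE; apply.
- move=> v; rewrite bdB bd_edge cp fp /wsign /= big_cons rmorphM /=.
  by rewrite /walk_end /=; ring.
move=> ew; rewrite eqxx (suppP fA) ?inE // mulr0 subr0 mulr1 //.
Qed.

Lemma wsignE w : uniq (unzip1 w) -> cycle_sign S (walk_edges w) = wsign w.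
Proof.
move=> u1; rewrite /cycle_sign /wsign [RHS]big_uniq //.
by apply: eq_bigl => e; rewrite inE.
Qed.

Lemma wsign_cat w1 w2 : wsign (w1 ++ w2) = wsign w1 * wsign w2.
Proof. by rewrite /wsign /unzip1 map_cat big_cat. Qed.

Lemma wsign_pm1 w : wsign w = 1 \/ wsign w = -1.
Proof.
rewrite /wsign; elim/big_rec: _ => [|e s _ IH]; first by left.
by case: (sigma_pm1 S e) IH => -> [] ->; [left|right|right|left].
Qed.

Lemma cycle_sign_pm1 A : cycle_sign S A = 1 \/ cycle_sign S A = -1.
Proof.
rewrite /cycle_sign; elim/big_rec: _ => [|e s _ IH]; first by left.
by case: (sigma_pm1 S e) IH => -> [] ->; [left|right|right|left].
Qed.

Lemma closed_path_sign x w : closed_path S x w ->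
  cycle_sign S (walk_edges w) = wsign w.
Proof. by case/and5P=> _ _ _ _; apply: wsignE. Qed.

Lemma positive_dependent x w : closed_path S x w ->
    cycle_sign S (walk_edges w) = 1 ->
  exists f, [/\ cycle_space f, supp f \subset walk_edges w & supp f != set0].
Proof.
move=> cw; rewrite (closed_path_sign cw) => s1.
case/and5P: cw s1; case: w => // -[e y] w _ ww /eqP we _ /= /andP[ew _] s1.
have [f [fA fp fe]] := walk_fills_head ww.
exists f; split=> //; last by apply/set0Pn; exists e; rewrite inE fe.
by move=> v; rewrite fp we s1 mul1r subrr.
Qed.

(** With sign -1 the two end terms add up to twice the base vertex, hence the factor 1/2. *)
Lemma negative_fills x w y : closed_path S x w ->
    cycle_sign S (walk_edges w) = -1 -> y \in unzip2 w ->
  fills (walk_edges w) (fun v => (v == y)%:R).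
Proof.
move=> cw + yw; have [w' cw' <-] := closed_path_at cw yw.
rewrite (closed_path_sign cw') => s1.
case/and5P: cw' s1 => _ ww /eqP we _ _ s1.
have [f [fA fp _]] := walk_fills_head ww.
have : fills (walk_edges w') (fun v => 2^-1 * bd f v) by apply: fillsZ; exists f.
by apply: eq_fills => v; rewrite fp we s1; field.
Qed.

(** The first edge is the only one of the path at [x], so its coefficient vanishes; then induct on
    the rest. *)
Lemma path_independent x w f : simple_path S x w -> supp f \subset walk_edges w ->
  (forall v, v != walk_end x w -> bd f v = 0) -> forall e, f e = 0.
Proof.
elim: w x => [|[e y] w IHw] x.
  by move=> _ fA _ e; apply: suppP fA _; rewrite inE.
case/andP=> /andP[je ww] /andP[xw uw] fA fp.
have xe : x != walk_end x ((e, y) :: w).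
  by apply: contraNneq xw => ->; rewrite walk_end_in.
have fe : f e = 0.
  have := fp x xe; rewrite /bd (bigD1 e) //= big1 ?addr0 => [/eqP|g ge].
    rewrite mulf_eq0 inc_eq0 => /orP[/eqP//|].
    by case/andP: je => _ /eqP->; rewrite !inE eqxx.
  have [gw|gw] := boolP (g \in unzip1 w); last first.
    by rewrite (suppP fA) ?mul0r // !inE negb_or ge.
  apply/eqP; rewrite mulf_eq0 inc_eq0; apply/orP; right.
  apply: contra xw => xg; apply: verts_walk ww _.
  by apply/mem_verts; exists g; rewrite ?inE.
apply: (IHw y) => //; first by apply/andP; split.
apply/subsetP => g gf; have := subsetP fA g gf; rewrite !inE.
by case: eqVneq => //= ge; move: gf; rewrite ge inE fe eqxx.
Qed.

(* Cancelling the first edge with the chain of the closed walk, which has     *)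
(* boundary 2x, leaves a chain on a path with boundary at x only: it is 0.    *)
Lemma negative_independent x w f : closed_path S x w ->
    cycle_sign S (walk_edges w) = -1 -> supp f \subset walk_edges w ->
  cycle_space f -> supp f = set0.
Proof.
move=> cw; rewrite (closed_path_sign cw) => s1 fA Kf.
case/and5P: cw s1 fA; case: w => // -[e y] w _ ww /eqP we uw /= /andP[ew u1] s1 fA.
have [h [hA hp /(_ ew) he]] := walk_fills_head ww.
pose f' g := f g - f e / h e * h g.
have f'A : supp f' \subset walk_edges w.
  apply/subsetP => g gf'; have : supp f' \subset walk_edges ((e, y) :: w).
    exact: suppB.
  move/subsetP/(_ g gf'); rewrite !inE => /orP[/eqP ge|//].
  by move: gf'; rewrite ge inE /f' mulfVK // subrr eqxx.
have sw : simple_path S y w by case/andP: ww => _ ww; apply/andP; split.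
have bdf' v : bd f' v = - (f e / h e) * (2 * (v == x)%:R).
  by rewrite /f' bdB Kf hp we s1; ring.
have f'0 : forall g, f' g = 0.
  apply: path_independent sw f'A _ => v; rewrite (we : walk_end y w = x) => vx.
  by rewrite bdf' (negPf vx) !mulr0.
have c0 : f e / h e = 0.
  have : bd f' x = 0 by rewrite /bd big1 // => g _; rewrite f'0 mul0r.
  rewrite bdf' eqxx mulr1 => /eqP.
  by rewrite mulf_eq0 oppr_eq0 orbF => /eqP.
apply/setP => g; rewrite !inE; apply/negbTE; rewrite negbK.
by have := f'0 g; rewrite /f' c0 mul0r subr0 => ->.
Qed.

Lemma cycle_space_deg2 f v e : cycle_space f -> e \in supp f ->
  v \in ends S e -> exists2 g, g \in supp f & (g != e) && (v \in ends S g).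
Proof.
move=> Kf; rewrite inE => fe ve.
have [g|/= all0] := pickP [pred g | (g \in supp f) && ((g != e) && (v \in ends S g))].
  by case/andP=> gf gv; exists g.
have /eqP := Kf v; rewrite /bd (bigD1 e) //= big1 ?addr0 => [|g ge].
  by rewrite mulf_eq0 inc_eq0 ve (negPf fe).
apply/eqP; rewrite mulf_eq0 inc_eq0.
by have := all0 g; rewrite /= inE ge /=; case: (f g == 0) => //= ->.
Qed.

Lemma tight_dependent A B v : fills A (fun u => (u == v)%:R) ->
    fills B (fun u => (u == v)%:R) -> [disjoint A & B] ->
  exists f, [/\ cycle_space f, supp f \subset A :|: B & supp f != set0].
Proof.
case=> f fA fp [h hB hp] dAB; exists (fun e => f e - 1 * h e); split.
- by move=> u; rewrite bdB fp hp mul1r subrr.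
- apply: suppB; first exact: subset_trans fA (subsetUl _ _).
  exact: subset_trans hB (subsetUr _ _).
have [e fe|f0] := pickP (fun e => f e != 0).
  apply/set0Pn; exists e; rewrite inE (suppP hB) ?mulr0 ?subr0 //.
  by apply: contraTN fe => eB; rewrite (suppP fA) ?eqxx // (disjointFl dAB).
have /eqP := fp v; rewrite eqxx /bd big1 // => e _.
by have /negbFE/eqP-> := f0 e; rewrite mul0r.
Qed.

Hypothesis no_disjoint_negative : ~ exists C1 C2,
  [/\ negative_cycle S C1, negative_cycle S C2
    & [disjoint verts S C1 & verts S C2]].

(* If Z contains a negative cycle C, then Z \ C has either a second cycle     *)
(* meeting C in one vertex, or a path joining two vertices of C; in the       *)
(* resulting theta one of the two cycles through the path is positive.        *)
Lemma min_support_circuit Z : min_support cycle_space Z -> Z != set0 ->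
  sg_circuit S Z.
Proof.
move=> [[f Kf fZ] minZ] Zn0.
(* Consequently it is enough to find, inside [Z], a circuit that carries a nonzero kernel vector. *)
have Z_eq h A : cycle_space h -> supp h \subset A -> supp h != set0 ->
    A \subset Z -> A = Z.
  move=> Kh hA h0 AZ; apply/eqP; rewrite eqEsubset AZ -(minZ h) //.
  exact: subset_trans AZ.
have posZ x w : closed_path S x w -> walk_edges w \subset Z ->
    cycle_sign S (walk_edges w) = 1 -> sg_circuit S Z.
  move=> cw wZ s1; have [h [Kh hw h0]] := positive_dependent cw s1.
  apply: Or31; rewrite -(Z_eq h _ Kh hw h0 wZ); split=> //.
  by apply: Or31; exists x, w.
have degZ v e : e \in Z -> v \in ends S e ->
    exists2 g, g \in Z & (g != e) && (v \in ends S g).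
  by rewrite -fZ; apply: cycle_space_deg2.
(* With [T] empty no path can end in [T], so a closed path must appear. *)
have [[x [w [cw wZ _]]]|[x [w [_]]]] : _ \/ _ := ear_exists (T := set0) links Zn0
  (fun v e _ => degZ v e); last by rewrite inE.
have [s1|s1] := cycle_sign_pm1 (walk_edges w); first exact: posZ cw wZ s1.
have ncw : negative_cycle S (walk_edges w).
  by split=> //; apply: Or31; exists x, w.
have Fn0 : Z :\: walk_edges w != set0.
  apply: contra Zn0; rewrite setD_eq0 -fZ => fw.
  by rewrite (negative_independent cw s1 fw Kf).
have sF : Z :\: walk_edges w \subset Z by apply: subsetDl.
have degF v e : v \notin verts S (walk_edges w) -> e \in Z :\: walk_edges w ->
    v \in ends S e ->
    exists2 g, g \in Z :\: walk_edges w & (g != e) && (v \in ends S g).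
  move=> vw; rewrite inE => /andP[_ eZ] ve; have [g gZ gv] := degZ v e eZ ve.
  exists g => //; rewrite inE gZ andbT; apply: contra vw => gw.
  by apply/mem_verts; exists g => //; case/andP: gv.
case: (ear_exists links Fn0 degF) => [[z [w' [cw' w'F w'T]]]|].
  have w'Z := subset_trans w'F sF.
  have [s1'|s1'] := cycle_sign_pm1 (walk_edges w'); first exact: posZ cw' w'Z s1'.
  have ncw' : negative_cycle S (walk_edges w').
    by split=> //; apply: Or31; exists z, w'.
  have dww' : [disjoint walk_edges w & walk_edges w'].
    rewrite disjoint_sym; apply/pred0P => e /=; apply/negbTE/negP => /andP[ew' ew].
    by have := subsetP w'F e ew'; rewrite inE ew.
  have sub1 : verts S (walk_edges w) :&: verts S (walk_edges w') \subset [set z].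
    apply/subsetP => v; rewrite !inE (verts_closed cw') => /andP[vw vw'].
    by rewrite (w'T v).
  (* A closed ear might miss [T] altogether; here that would give two disjoint negative cycles. *)
  have vz : verts S (walk_edges w) :&: verts S (walk_edges w') = [set z].
    apply/eqP; rewrite eqEsubset sub1 /=.
    have [I0|/set0Pn[v vI]] :=
      eqVneq (verts S (walk_edges w) :&: verts S (walk_edges w')) set0.
      case: no_disjoint_negative; exists (walk_edges w), (walk_edges w').
      by split=> //; rewrite -setI_eq0 I0.
    by have := subsetP sub1 v vI; rewrite !inE => /eqP <-; rewrite sub1set.
  have /setP/(_ z) := vz; rewrite !inE eqxx (verts_closed cw) (verts_closed cw').
  case/andP=> zw zw'.
  have [h [Kh hA h0]] := tight_dependent (negative_fills cw s1 zw)
    (negative_fills cw' s1' zw') dww'.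
  apply: Or33; exists (walk_edges w), (walk_edges w'); split=> //.
  - move=> ww'; move: dww'; rewrite -ww' -setI_eq0 setIid.
    by move=> /eqP w0; rewrite -(verts_closed cw) w0 /verts big_set0 inE in zw.
  - by rewrite vz cards1.
  - by rewrite (Z_eq h _ Kh hA h0) // subUset wZ w'Z.
case=> x0 [R [[sR Rn0 RF RT] x0T yT]].
have RZ := subset_trans RF sF.
set y := walk_end x0 R in RT yT.
rewrite (verts_closed cw) in x0T.
have x0y : x0 != y.
  case/andP: sR => _ /andP[x0R _].
  by apply: contraNneq x0R => ->; apply: walk_end_in.
have [w1 cw1 ew1] := closed_path_at cw x0T.
have yw1 : y \in unzip2 w1 by rewrite -(verts_closed cw1) ew1.
have [P [Q [ePQ eP]]] : exists P Q, w1 = P ++ Q /\ walk_end x0 P = y.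
  by apply: walk_split; rewrite inE yw1 orbT.
have Pn0 : P != [::] by apply: contraNneq x0y => P0; rewrite -eP P0.
have dRw : [disjoint walk_edges R & walk_edges w].
  apply/pred0P => e /=; apply/negbTE/negP => /andP[eR ew].
  by have := subsetP RF e eR; rewrite inE ew.
have eQ : walk_end y Q = x0.
  by move: cw1; rewrite ePQ => /and5P[_ _ /eqP]; rewrite walk_end_cat eP.
have Qn0 : Q != [::] by apply: contraNneq x0y => Q0; rewrite -eQ Q0.
rewrite ePQ in ew1 cw1.
have cRQ : closed_path S x0 (R ++ Q).
  by apply: theta_closed_path cw1 eP Pn0 sR erefl Rn0 _ _; rewrite ew1.
have [R' [sR' eR' R'1 R'2]] := simple_path_rev sR.
have cQP : closed_path S y (Q ++ P) by rewrite -eP; apply: closed_path_rot.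
have eR'R : walk_edges R' = walk_edges R.
  by apply/setP => e; rewrite !inE R'1 mem_rev.
have R'n0 : R' != [::].
  by rewrite -size_eq0 -(size_map fst) [map _ _]R'1 size_rev size_map size_eq0.
have cRP : closed_path S y (R' ++ P).
  apply: theta_closed_path cQP eQ Qn0 sR' eR' R'n0 _ _.
    move=> v; rewrite R'2 mem_rev walk_edges_catC ew1 => vR vT.
    by case: (RT v vR vT); [right|left].
  by rewrite eR'R walk_edges_catC ew1.
have catZ (R1 Q1 : seq (E * V)) :
    walk_edges R1 \subset Z -> walk_edges Q1 \subset walk_edges w ->
    walk_edges (R1 ++ Q1) \subset Z.
  move=> /subsetP R1Z /subsetP Q1w; apply/subsetP => e.
  rewrite inE /unzip1 map_cat mem_cat => /orP[eR1|eQ1].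
    by apply: R1Z; rewrite inE.
  by apply: (subsetP wZ); apply: Q1w; rewrite inE.
have Pw : walk_edges P \subset walk_edges w.
  by apply/subsetP => e; rewrite -ew1 !inE /unzip1 map_cat mem_cat => ->.
have Qw : walk_edges Q \subset walk_edges w.
  by apply/subsetP => e; rewrite -ew1 !inE /unzip1 map_cat mem_cat orbC => ->.
(* The signs of the three cycles of the theta multiply to 1, each arc counting twice. The cycle of
   [P] and [Q] is negative, so one of the other two is positive. *)
have [sRQ|sRQ] := cycle_sign_pm1 (walk_edges (R ++ Q)).
  exact: posZ cRQ (catZ _ _ RZ Qw) sRQ.
apply: (posZ _ _ cRP); first by apply: catZ; rewrite ?eR'R.
move: sRQ s1; rewrite -ew1 (closed_path_sign cRP) (closed_path_sign cRQ).
rewrite (closed_path_sign cw1) !wsign_cat.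
have -> : wsign R' = wsign R by rewrite /wsign R'1; apply: perm_big; rewrite perm_rev.
by case: (wsign_pm1 R) (wsign_pm1 P) (wsign_pm1 Q) => -> [] -> [] ->.
Qed.

End Incidence.

(** * From 2-connectedness to circuits through any two edges *)

Section TwoConnected.
Variables (V E : finType) (S : signed_graph V E).
Hypothesis links : forall e, #|ends S e| = 2%N.
Hypothesis conS : two_connected S.
Implicit Types (u v w x y z : V) (e g : E).

Definition star w : {set E} := [set e | w \in ends S e].

Definition adj_off w : rel V :=
  [rel x y | [exists e, (e \notin star w) && joins S e x y]].

Lemma exists_incident x y : x != y -> exists e, x \in ends S e.
Proof.
move=> xy; case: conS => conG _.
have /connectP[[|s p]] := conG (inl x) (inl y).
  by move=> _ [yx]; rewrite yx eqxx in xy.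
by case/andP; case: s => // e xe _ _; exists e.
Qed.

(** If [w] separated [x] from [y], the edges meeting the component [U] of [x] and the remaining
    edges could share only [w], a 1-separation. *)
Lemma connect_off w x y : x != w -> y != w -> connect (adj_off w) x y.
Proof.
move=> xw yw; apply/negPn/negP => nxy; case: conS => conG; apply.
pose U := [set u | connect (adj_off w) x u].
pose A := [set e | [exists u, (u \in U) && (u \in ends S e)]].
have xU : x \in U by rewrite inE connect0.
have yU : y \notin U by rewrite inE.
have wU : w \notin U.
  rewrite inE; apply/negP => /connectP[p].
  elim/last_ind: p => [_ /= wx|p s _]; first by case/eqP: xw.
  rewrite rcons_path last_rcons => /andP[_ /existsP[e /andP[ew je]]] ws.
  by case/andP: je ew => _ /eqP je; rewrite inE je ws !inE eqxx orbT.
have AU e v : e \in A -> v \in ends S e -> v != w -> v \in U.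
  rewrite inE => /existsP[u /andP[uU ue]] ve vw.
  have [t jt] := joins_ends links ue; case/andP: (jt) => _ /eqP je.
  move: ve; rewrite je !inE => /orP[/eqP->|/eqP vt]; first by rewrite inE in uU.
  have := uU; rewrite !inE => /connect_trans; apply; apply: connect1.
  apply/existsP; exists e; rewrite vt jt andbT inE je !inE negb_or.
  by rewrite -vt [w == v]eq_sym vw andbT; apply: contraNneq wU => ->.
have [a xa] : exists a, x \in ends S a.
  by apply: (exists_incident (y := y)); apply: contraNneq yU => <-.
have [b yb] : exists b, y \in ends S b.
  by apply: (exists_incident (y := x)); apply: contraNneq yU => ->.
have aA : a \in A by rewrite inE; apply/existsP; exists x; rewrite xU.
have bA : b \notin A by apply: contra yU => bA; apply: AU bA yb yw.
have AA : A :|: ~: A = [set: E] by rewrite setUCr.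
exists A, (~: A); split.
- by rewrite AA -setI_eq0 setICr.
- rewrite leq_min !card_gt0; apply/andP; split; apply/set0Pn.
    by exists a.
  by exists b; rewrite inE.
apply/eqP; rewrite eqn_leq card_gt0 connected_verts ?andbT //.
- rewrite -(cards1 w) subset_leq_card //; apply/subsetP => v.
  rewrite !inE => /andP[/mem_verts[e eA ve] /mem_verts[g gA vg]].
  apply: contraTT gA => vw; rewrite inE negbK inE.
  by apply/existsP; exists v; rewrite (AU e).
- by apply/set0Pn; exists a.
- by apply/set0Pn; exists b; rewrite !inE in bA *; rewrite bA.
Qed.

(** Adding a multiple of the column of an edge moves the realised vertex across that edge. *)
Lemma connected_off_fills w x y :
    x != w -> y != w -> fills S (~: star w) (fun v => (v == x)%:R) ->
  fills S (~: star w) (fun v => (v == y)%:R).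
Proof.
move=> xw yw; have /connectP[p pp ->] := connect_off xw yw.
elim: p x pp {xw} => //= z p IHp x /andP[/existsP[e /andP[ew je]] pp] fx.
apply: IHp pp _; have [c c0 cp] := inc_joins links je.
have fe : fills S (~: star w) (fun v => c * inc S e v).
  exists (fun g => c * (g == e)%:R); last by move=> v; rewrite bd_edge.
  apply/subsetP => g; rewrite !inE.
  have [->|ge] := eqVneq g e; last by rewrite mulr0 eqxx.
  by rewrite inE in ew.
have := fillsZ (sigma S e)%:~R (fillsB 1 fx fe); apply: eq_fills => v.
rewrite cp mul1r opprB addrC subrK mulrA -[RHS]mul1r.
by rewrite sigma_sqr.
Qed.

Hypothesis tangledS : tangled S.

Lemma off_fills w y : y != w -> fills S (~: star w) (fun v => (v == y)%:R).
Proof.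
move=> yw; case: tangledS => _ nbal _.
have /NNPP[C Cw [cC sC]] : ~ balanced S [set e | w \notin ends S e].
  by move=> bw; apply: nbal; exists w.
case: cC => [[x [p [cp eC]]]|[e eh _]|[e e0 _]]; last 2 first.
- by have := link_not_half links e; rewrite eh.
- by have := links e; rewrite e0 cards0.
rewrite eC in Cw sC.
have xp : x \in unzip2 p.
  by case/and5P: cp => pn0 _ /eqP px _ _; rewrite -[X in X \in _]px walk_end_in.
have xw : x != w.
  apply: contraTneq xp => ->; rewrite -(verts_closed cp); apply/negP.
  by move=> /mem_verts[e ep we]; have := subsetP Cw e ep; rewrite inE we.
apply: (connected_off_fills xw yw).
apply: fillsS (negative_fills links cp sC xp).
by apply: subset_trans Cw _; apply/subsetP => e; rewrite !inE.
Qed.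

Lemma adjacent_min_support w a b : a != b -> w \in ends S a -> w \in ends S b ->
  exists Z, [/\ min_support (cycle_space S) Z, a \in Z & b \in Z].
Proof.
move=> ab wa wb.
have [u ju] := joins_ends links wa; have [v jv] := joins_ends links wb.
have [c c0 cp] := inc_joins links ju; have [d d0 dp] := inc_joins links jv.
have [|h hw hp] := @off_fills w u; first by rewrite eq_sym (joins_neq links ju).
have [|k kw kp] := @off_fills w v; first by rewrite eq_sym (joins_neq links jv).
(* The chains built on [a] and on [b] both have boundary [w], since [h] and [k] absorb the far ends;
   their difference is a kernel vector, and [h], [k] avoid [w]. *)
pose f g := c * (g == a)%:R - (- (sigma S a)%:~R) * h g
          - 1 * (d * (g == b)%:R - (- (sigma S b)%:~R) * k g).
have Kf : cycle_space S f.
  by move=> t; rewrite !bdB !bd_edge cp dp hp kp; ring.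
have f0 g : g \in star w -> f g = c * (g == a)%:R - d * (g == b)%:R.
  by move=> gw; rewrite /f (suppP hw) ?(suppP kw) ?inE ?negbK //; last first;
    rewrite ?inE // in gw *; ring.
have fa : f a != 0 by rewrite f0 ?inE // eqxx (negPf ab) mulr0 subr0 mulr1.
have [Z [mZ Zf aZ]] := min_support_sub (@cycle_spaceB _ _ S) Kf fa.
exists Z; split=> //; have [[h' Kh' hZ] _] := mZ.
rewrite -hZ in aZ; have [g gZ /andP[ga wg]] := cycle_space_deg2 Kh' aZ wa.
rewrite hZ in gZ; have := subsetP Zf g gZ; rewrite inE f0 ?inE //.
by have [<-|gb] := eqVneq g b; rewrite ?gZ // (negPf ga) !mulr0 subr0 eqxx.
Qed.

Lemma two_connected_circuits e g : e != g ->
  exists Z, [/\ sg_circuit S Z, e \in Z & g \in Z].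
Proof.
move=> eg.
pose rel_e h := h = e \/
  exists Z, [/\ min_support (cycle_space S) Z, e \in Z & h \in Z].
(* At a vertex the invariant covers all its edges, so it passes along both kinds of incidence. *)
pose inv (s : V + E) := match s with
  | inl v => forall h, v \in ends S h -> rel_e h | inr h => rel_e h end.
have inv_step s t : incident S s t -> inv s -> inv t.
  case: s t => [v|h] [u|k] //=; first by move=> vk; apply.
  move=> uh reh k uk; have [->|kh] := eqVneq k h; first by [].
  have [Z [mZ hZ kZ]] : exists Z, [/\ min_support (cycle_space S) Z, h \in Z & k \in Z].
    by apply: (adjacent_min_support _ uh uk); rewrite eq_sym.
  case: reh => [he|[Z' [mZ' eZ' hZ']]]; first by right; exists Z; rewrite -he.
  right; exact: (min_support_trans (@cycle_spaceB _ _ S) mZ' mZ hZ' hZ eZ' kZ).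
have [ge|[Z [mZ eZ gZ]]] : rel_e g.
  case: conS => /(_ (inr e) (inr g)) /connectP[p pp lp] _.
  rewrite -[rel_e g]/(inv (inr g)) lp.
  have : inv (inr e) by left.
  elim: p (inr e) pp {lp} => //= s p IHp t /andP[ts pp] /(inv_step _ _ ts).
  exact: IHp.
  by rewrite ge eqxx in eg.
exists Z; split=> //; apply: (min_support_circuit links _ mZ).
  by case: tangledS.
by apply/set0Pn; exists e.
Qed.

End TwoConnected.

(** * No circuit crosses a 1-separation *)

Section Separated.
Variables (V E : finType) (S : signed_graph V E).

Lemma separation_circuit A B C e g : tangled S -> is_separation S 1 A B ->
  sg_circuit S C -> e \in A -> e \in C -> g \in B -> g \in C -> False.
Proof.
case=> _ nbal ndis [[AB dAB] _ /eqP/cards1P[v vAB]] + eA eC gB gC.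
have BA0 : B :&: A = set0 by apply/eqP; rewrite setI_eq0 disjoint_sym.
have one_side D : is_cycle S D -> D \subset A \/ D \subset B.
  by apply: (cycle_one_side (v := v)) => //; rewrite vAB.
have notAB h : h \in A -> h \in B -> False.
  by move=> hA hB; have /setP/(_ h) := BA0; rewrite !inE hA hB.
have [C0 C0v nC0] : exists2 C0 : {set E}, C0 \subset [set e | v \notin ends S e]
    & negative_cycle S C0.
  by apply: NNPP => bal; apply: nbal; exists v.
have no_split C1 C2 : negative_cycle S C1 -> negative_cycle S C2 ->
    C1 \subset A -> C2 \subset B -> False.
  move=> n1 n2 C1A C2B; apply: ndis.
  (* [C0] avoids [v], the only vertex common to both sides, so it is disjoint from any cycle on the
     side opposite to its own. *)
  have C0sep (C' X Y : {set E}) : C0 \subset X -> C' \subset Y ->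
      verts S X :&: verts S Y = [set v] -> [disjoint verts S C0 & verts S C'].
    move=> C0X C'Y XY; apply/pred0P => u /=; apply/negbTE/negP => /andP[u0 u'].
    have : u \in verts S X :&: verts S Y.
      by rewrite inE (subsetP (vertsS _ C0X)) ?(subsetP (vertsS _ C'Y)).
    rewrite XY inE => /eqP uv; move: u0; rewrite uv => /mem_verts[h h0 vh].
    by have := subsetP C0v h h0; rewrite inE vh.
  have [C0A|C0B] := one_side C0 (proj1 nC0).
    by exists C0, C2; split=> //; apply: C0sep C0A C2B vAB.
  by exists C0, C1; split=> //; apply: C0sep C0B C1A _; rewrite setIC.
case=> [[cC _]|[C1 [C2 [x [w [[n1 n2 d12] _]]]]]|[C1 [C2 [n1 n2 _ _ eCC]]]].
- have [/subsetP sC|/subsetP sC] := one_side C cC.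
    exact: (notAB g (sC g gC) gB).
  exact: (notAB e eA (sC e eC)).
- by apply: ndis; exists C1, C2.
have [C1A|C1B] := one_side C1 (proj1 n1); have [C2A|C2B] := one_side C2 (proj1 n2).
- apply: (notAB g) => //; have /subsetP : C \subset A by rewrite eCC subUset C1A.
  exact.
- exact: no_split n1 n2 C1A C2B.
- exact: no_split n2 n1 C2A C1B.
- apply: (notAB e) => //; have /subsetP : C \subset B by rewrite eCC subUset C1B.
  exact.
Qed.

End Separated.

Theorem theorem2p9 (V E : finType) (S : signed_graph V E) :
  tangled S -> (two_connected S <-> matroid_connected (sg_circuit S)).
Proof.
move=> tS; split=> [tcS e f ef|mS].
  have links := two_connected_links tcS ef.
  exact: two_connected_circuits links tcS tS e f ef.
split; first by case: tS.
case=> A [B sepAB]; have [[_ dAB]] := sepAB.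
rewrite leq_min !card_gt0 => /andP[/set0Pn[e eA] /set0Pn[f fB]] _.
have ef : e != f.
  by apply: contraTneq fB => <-; rewrite (disjointFr dAB).
have [C [cC eC fC]] := mS e f ef.
exact: separation_circuit tS sepAB cC eA eC fB fC.
Qed.
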